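(* Let $B\times_fF$ be a degenerate warped product, let $X,Y,Z\in\Gamma(TB)$ and $U,V,W\in\Gamma(TF)$ (lifted to $B\times F$), and let $P\in\Gamma(TF)$ (lifted). Let $\widehat{\mathcal K}$ be the semi-symmetric non-metric Koszul form on $B\times_fF$ associated with $P$, and let $\mathcal K_B$, $\mathcal K_F$ be the lifts of the Koszul forms of $(B,g_B)$, $(F,g_F)$. Then: (1) $\widehat{\mathcal K}(X,Y,Z)=\mathcal K_B(X,Y,Z)$; (2) $\widehat{\mathcal K}(X,Y,W)=\widehat{\mathcal K}(W,X,Y)=0$; (3) $\widehat{\mathcal K}(X,W,Y)=f^2g_B(X,Y)g_F(P,W)$; (4) $\widehat{\mathcal K}(X,V,W)=\widehat{\mathcal K}(V,X,W)=-\widehat{\mathcal K}(V,W,X)=f\,g_F(V,W)\,X(f)$; (5) $\widehat{\mathcal K}(U,V,W)=f^2\mathcal K_F(U,V,W)+f^4g_F(V,P)g_F(U,W)$.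
   Context: A singular semi-Riemannian manifold is a smooth manifold with a smooth symmetric $(0,2)$-tensor field $g=\langle\cdot,\cdot\rangle$, possibly degenerate and of varying signature. Its Koszul form is $\mathcal K(X,Y,Z)=\tfrac12\{X\langle Y,Z\rangle+Y\langle Z,X\rangle-Z\langle X,Y\rangle-\langle X,[Y,Z]\rangle+\langle Y,[Z,X]\rangle+\langle Z,[X,Y]\rangle\}$, and the semi-symmetric non-metric Koszul form associated with a vector field $P$ is $\widehat{\mathcal K}(X,Y,Z)=\mathcal K(X,Y,Z)+g(Y,P)g(X,Z)$. Let $(B,g_B)$, $(F,g_F)$ be singular semi-Riemannian manifolds and $f\in C^\infty(B)$ (which may vanish at some points). The (degenerate) warped product $B\times_fF$ is $B\times F$ with the metric $\pi_B^*(g_B)+(f\circ\pi_B)^2\pi_F^*(g_F)$, where $\pi_B,\pi_F$ are the projections. Functions, vector fields and forms on $B$ and $F$ are identified with their lifts to $B\times F$. *)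

(* Defs.v *)
From HB Require Import structures.
From mathcomp Require Import all_boot all_order all_algebra.
From mathcomp Require Import all_classical all_reals all_analysis.
From mathcomp Require Import ring.
Set Implicit Arguments.
Unset Strict Implicit.
Unset Printing Implicit Defensive.
Import Order.TTheory GRing.Theory Num.Theory.
Import numFieldNormedType.Exports.
Local Open Scope classical_set_scope.
Local Open Scope ring_scope.

Section Calculus.
Context {R : realType}.

(* [U] is meant to be open; only the values of [f] on [U] matter (see [Cn_eq]). *)
Fixpoint Cn {V W : normedModType R} (n : nat) (U : set V) (f : V -> W) : Prop :=
  if n is m.+1 then
    (forall x, U x -> differentiable f x) /\ (forall v, Cn m U ('D_v f))
  else forall x, U x -> {for x, continuous f}.

Definition smooth_on {V W : normedModType R} (U : set V) (f : V -> W) :=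
  forall n, Cn n U f.

Section Closure.
Context {V W : normedModType R}.
Implicit Types (U : set V) (f g : V -> W).

Lemma near_open U x (P : V -> Prop) : open U -> U x -> (forall y, U y -> P y) ->
  \forall y \near x, P y.
Proof. by move=> oU Ux UP; apply: filterS UP _; apply: open_nbhs_nbhs. Qed.

Lemma near_eq_differentiable f g x : (\forall y \near x, f y = g y) ->
  differentiable f x -> differentiable g x.
Proof.
move=> fg df.
have fgx : f x = g x by exact: nbhs_singleton fg.
have E : g \o shift x = cst (g x) + 'd f x +o_ 0 id.
  apply/eqaddoP => _/posnumP[e].
  have /eqaddoP/(_ e%:num)/(_ [gt0 of e%:num]) := diff_locally df.
  have : \forall h \near (0 : V), f (h + x) = g (h + x).
    by move: fg; rewrite (near_shift 0 x)/=; apply: filterS => h;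
       rewrite /= subr0.
  apply: filter_app2; near=> h.
  by rewrite !fctE /= => Eh; rewrite -Eh -fgx.
have cd : continuous ('d f x) by exact: diff_continuous.
by apply/diff_locallyP; rewrite (diff_unique cd E).
Unshelve. all: by end_near. Qed.

Lemma Cn_eq n U f g : open U -> (forall x, U x -> f x = g x) ->
  Cn n U f -> Cn n U g.
Proof.
elim: n f g => [|n IH] f g oU fg /=.
  move=> cf x Ux; rewrite /prop_for /continuous_at; have <- := fg x Ux.
  apply: cvg_trans (cf x Ux); apply: near_eq_cvg.
  by apply: near_open oU Ux _ => y /fg.
move=> [df Df]; split=> [x Ux|v].
  by apply: near_eq_differentiable (df x Ux); apply: near_open oU Ux fg.
apply: (IH ('D_v f)) (Df v) => // x Ux.
by apply: near_eq_derive; apply: near_open oU Ux fg.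
Qed.

Lemma Cn_sub n U U' f : U' `<=` U -> Cn n U f -> Cn n U' f.
Proof.
elim: n f => [|n IH] f sU /= ; first by move=> cf x /sU /cf.
by move=> [df Df]; split=> [x /sU /df|v] //; apply: IH (Df v).
Qed.

Lemma CnD n U f g : open U -> Cn n U f -> Cn n U g -> Cn n U (f + g).
Proof.
move=> oU; elim: n f g => [|n IH] f g /=.
  by move=> cf cg x Ux; apply: continuousD; [exact: cf|exact: cg].
move=> [df Df] [dg Dg]; split=> [x Ux|v].
  by apply: differentiableD; [exact: df|exact: dg].
apply: (Cn_eq (f := 'D_v f + 'D_v g)) (IH _ _ (Df v) (Dg v)) => // x Ux.
by rewrite deriveD//; apply: diff_derivable => //; [exact: df|exact: dg].
Qed.

Lemma smooth_onD U f g :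
  open U -> smooth_on U f -> smooth_on U g -> smooth_on U (f + g).
Proof. by move=> oU sf sg n; apply: CnD. Qed.

End Closure.

Lemma CnM {V : normedModType R} n (U : set V) (f g : V -> R) :
  open U -> Cn n U f -> Cn n U g -> Cn n U (f * g).
Proof.
move=> oU; elim: n f g => [|n IH] f g.
  by move=> cf cg x Ux; apply: continuousM; [exact: cf|exact: cg].
have lower m (h : V -> R) : Cn m.+1 U h -> Cn m U h.
  elim: m h => [|m IHm] h [dh Dh].
    by move=> x /dh; exact: differentiable_continuous.
  by split=> // v; exact: IHm (Dh v).
move=> Cf Cg; have [[df Df] [dg Dg]] := (Cf, Cg); split=> [x Ux|v].
  by apply: differentiableM; [exact: df|exact: dg].
apply: (Cn_eq (f := f * 'D_v g + g * 'D_v f)) => //.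
  move=> x Ux; have [dfx dgx] := (df x Ux, dg x Ux).
  by rewrite deriveM//; exact: diff_derivable.
by apply: CnD => //; apply: IH;
  [exact: lower Cf|exact: Dg|exact: lower Cg|exact: Df].
Qed.

Lemma smooth_onM {V : normedModType R} (U : set V) (f g : V -> R) :
  open U -> smooth_on U f -> smooth_on U g -> smooth_on U (f * g).
Proof. by move=> oU sf sg n; apply: CnM. Qed.

Lemma smooth_on_linl {V W W' : normedModType R} (U : set V) (f : V -> W)
    (L : {linear W -> W'}) :
  continuous L -> open U -> smooth_on U f -> smooth_on U (L \o f).
Proof.
move=> cL oU sf n; move/(_ n): sf; elim: n f => [|n IH] f /=.
  by move=> cf x Ux; apply: continuous_comp; [exact: cf|exact: cL].
have dL y : differentiable L y by exact: linear_differentiable.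
move=> [df Df]; split=> [x Ux|v].
  by apply: differentiable_comp; [exact: df|exact: dL].
apply: (Cn_eq (f := L \o 'D_v f)) (IH _ (Df v)) => // x Ux /=.
have dfx := df x Ux.
have dLfx : differentiable (L \o f) x by exact: differentiable_comp.
by rewrite (deriveE _ dfx) (deriveE _ dLfx) (diff_comp dfx (dL _))/= diff_lin.
Qed.

Lemma smooth_on_linr {V V' W : normedModType R} (U : set V') (f : V' -> W)
    (L : {linear V -> V'}) :
  continuous L -> open U -> smooth_on U f -> smooth_on (L @^-1` U) (f \o L).
Proof.
move=> cL oU sf n; move/(_ n): sf; elim: n f => [|n IH] f /=.
  by move=> cf x Ux; apply: continuous_comp; [exact: cL|exact: cf].
have dL y : differentiable L y by exact: linear_differentiable.
move=> [df Df]; split=> [x Ux|v].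
  by apply: differentiable_comp; [exact: dL|exact: df].
have oLU : open (L @^-1` U) by apply: open_comp => // ? _; exact: cL.
apply: (Cn_eq (f := 'D_(L v) f \o L)) (IH _ (Df (L v))) => // x Ux /=.
have dfx := df _ Ux.
have dfLx : differentiable (f \o L) x by exact: differentiable_comp.
by rewrite (deriveE _ dfx) (deriveE _ dfLx) (diff_comp (dL _) dfx)/= diff_lin.
Qed.

Lemma smooth_on_eq {V W : normedModType R} (U : set V) (f g : V -> W) :
  open U -> (forall x, U x -> f x = g x) -> smooth_on U f -> smooth_on U g.
Proof. by move=> oU fg sf n; apply: Cn_eq (sf n). Qed.

Lemma smooth_on_sub {V W : normedModType R} (U U' : set V) (f : V -> W) :
  U' `<=` U -> smooth_on U f -> smooth_on U' f.
Proof. by move=> sU sf n; apply: Cn_sub (sf n). Qed.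

End Calculus.

(* [cinv] is the inverse of [cmap] on [cmap @` cdom]; values of [cmap] outside
   [cdom], and of [cinv] outside [cmap @` cdom], are irrelevant. *)
Record chart (R : realType) (n : nat) (M : topologicalType) := Chart {
  cdom : set M;
  cmap : M -> 'rV[R]_n;
  cinv : 'rV[R]_n -> M;
  cdom_open : open cdom;
  cimg_open : open (cmap @` cdom);
  cmapK : {in cdom, cancel cmap cinv};
  cmap_cont : {in cdom, continuous cmap};
  cinv_cont : {in cmap @` cdom, continuous cinv} }.

(* The smooth structure is the one generated by [atlas], which need not be
   maximal. *)
Record manifold (R : realType) := Manifold {
  carrier :> topologicalType;
  dim : nat;
  atlas : set (chart R dim carrier);
  manifold_hausdorff : hausdorff_space carrier;
  manifold_second_countable : @second_countable carrier;
  atlas_cover : forall p : carrier, exists2 c, atlas c & cdom c p;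
  atlas_compat : forall c d, atlas c -> atlas d ->
    smooth_on (cmap c @` (cdom c `&` cdom d)) (cmap d \o cinv c) }.

Lemma cimgE (R : realType) n (M : topologicalType) (c : chart R n M) (A : set M) :
  cmap c @` (cdom c `&` A) = (cmap c @` cdom c) `&` (cinv c @^-1` A).
Proof.
rewrite eqEsubset; split=> [_ [p [cp Ap] <-]|_ [[p cp <-]]] /=.
  by split; [exists p|rewrite /= cmapK// inE].
by rewrite cmapK ?inE// => Ap; exists p.
Qed.

Lemma open_cimg (R : realType) n (M : topologicalType) (c : chart R n M) (A : set M) :
  open A -> open (cmap c @` (cdom c `&` A)).
Proof.
move=> oA; rewrite cimgE openE => z [cz Az].
apply: (@filterI _ (nbhs z)).
  by apply: open_nbhs_nbhs; split=> //; exact: cimg_open.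
have cc : {for z, continuous (cinv c)} by apply: cinv_cont; rewrite inE.
by apply: cc; apply: open_nbhs_nbhs; split.
Qed.

Section ProductTopology.
Context {M N : topologicalType}.

Lemma open_setM (A : set M) (B : set N) : open A -> open B -> open (A `*` B).
Proof.
move=> oA oB; rewrite openE => -[p q] [/= Ap Bq].
by exists (A, B) => //; split; apply: open_nbhs_nbhs.
Qed.

Lemma hausdorff_prod :
  hausdorff_space M -> hausdorff_space N -> hausdorff_space (M * N)%type.
Proof.
move=> hM hN [p q] [p' q'] H; congr pair.
  apply: hM => A B nA nB.
  have nA' : nbhs (p, q) (A `*` setT).
    by exists (A, setT) => //; split => //; exact: filterT.
  have nB' : nbhs (p', q') (B `*` setT).
    by exists (B, setT) => //; split => //; exact: filterT.
  by have [[a b] [[/= Aa _] [/= Ba _]]] := H _ _ nA' nB'; exists a.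
apply: hN => A B nA nB.
have nA' : nbhs (p, q) (setT `*` A).
  by exists (setT, A) => //; split => //; exact: filterT.
have nB' : nbhs (p', q') (setT `*` B).
  by exists (setT, B) => //; split => //; exact: filterT.
by have [[a b] [[/= _ Ab] [/= _ Bb]]] := H _ _ nA' nB'; exists b.
Qed.

Lemma second_countable_prod :
  @second_countable M -> @second_countable N -> @second_countable (M * N)%type.
Proof.
move=> [S cS [oS bS]] [T cT [oT bT]].
exists ((fun AB : set M * set N => AB.1 `*` AB.2) @` (S `*` T)).
  apply: sub_countable (card_image_le _ _) _.
  exact: countableX.
split=> [_ [[A B] [/= SA TB] <-]|[p q] W [[A B] [/= nA nB] sW]].
  by apply: open_setM; [exact: oS|exact: oT].
have [A' [SA' A'p] sA] := bS _ _ nA; have [B' [TB' B'q] sB] := bT _ _ nB.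
exists (A' `*` B'); first by split => //; exists (A', B').
by move=> [a b] [/= aA bB]; apply: sW; split; [exact: sA|exact: sB].
Qed.

End ProductTopology.

Section RowMx.
Context {R : realType} {m n : nat}.

Definition rowl (u : 'rV[R]_m) : 'rV[R]_(m + n) := row_mx u 0.
Definition rowr (v : 'rV[R]_n) : 'rV[R]_(m + n) := row_mx 0 v.

Fact rowl_linear : linear rowl.
Proof. by move=> a u v; rewrite /rowl scale_row_mx add_row_mx scaler0 addr0. Qed.
HB.instance Definition _ := GRing.isLinear.Build _ _ _ _ rowl rowl_linear.

Fact rowr_linear : linear rowr.
Proof. by move=> a u v; rewrite /rowr scale_row_mx add_row_mx scaler0 addr0. Qed.
HB.instance Definition _ := GRing.isLinear.Build _ _ _ _ rowr rowr_linear.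

Lemma row_mx_cvg {T} (F : set_system T) {FF : Filter F} (f : T -> 'rV[R]_m)
    (g : T -> 'rV[R]_n) (u : 'rV[R]_m) (v : 'rV[R]_n) :
  f @ F --> u -> g @ F --> v -> (fun t => row_mx (f t) (g t)) @ F --> row_mx u v.
Proof.
move=> fu gv; apply/cvg_ballP => e e0.
move/cvg_ballP/(_ e e0): fu; move/cvg_ballP/(_ e e0): gv.
apply: filter_app2; near=> t => -[_ gt] [_ ft]; split=> // i j.
by rewrite !mxE; case: (fintype.split j) => k; [exact: ft|exact: gt].
Unshelve. all: by end_near. Qed.

Lemma rowl_continuous : continuous rowl.
Proof.
move=> u; apply: (@row_mx_cvg _ (nbhs u) _ id (fun=> 0) u 0).
  by move=> A.
exact: cvg_cst.
Qed.

Lemma rowr_continuous : continuous rowr.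
Proof.
move=> u; apply: (@row_mx_cvg _ (nbhs u) _ (fun=> 0) id 0 u).
  exact: cvg_cst.
by move=> A.
Qed.

Lemma row_mx_lr u v : row_mx u v = rowl u + rowr v.
Proof. by rewrite /rowl /rowr add_row_mx addr0 add0r. Qed.

End RowMx.

Section ProductManifold.
Context {R : realType}.

Section ProductChart.
Context {m n : nat} {M N : topologicalType}.
Variables (c : chart R m M) (d : chart R n N).

Let pdom := cdom c `*` cdom d.
Let pmap (z : M * N) : 'rV[R]_(m + n) := row_mx (cmap c z.1) (cmap d z.2).
Let pinv (u : 'rV[R]_(m + n)) : M * N := (cinv c (lsubmx u), cinv d (rsubmx u)).

Lemma prod_imgE (A : set M) (B : set N) : pmap @` (A `*` B) =
  lsubmx @^-1` (cmap c @` A) `&` rsubmx @^-1` (cmap d @` B).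
Proof.
rewrite eqEsubset; split=> [_ [[p q] [/= Ap Bq] <-]|u [[p Ap pu] [q Bq qu]]].
  by rewrite /pmap/= /preimage/= row_mxKl row_mxKr; split; [exists p|exists q].
by exists (p, q) => //; rewrite /pmap /= pu qu hsubmxK.
Qed.

Fact prod_cdom_open : open pdom.
Proof. by apply: open_setM; exact: cdom_open. Qed.

Fact prod_cimg_open : open (pmap @` pdom).
Proof.
rewrite prod_imgE; apply: openI; apply: open_comp; try exact: cimg_open.
  by move=> ? _; exact: continuous_lsubmx.
by move=> ? _; exact: continuous_rsubmx.
Qed.

Fact prod_cmapK : {in pdom, cancel pmap pinv}.
Proof.
move=> [p q]; rewrite inE => -[/= cp dq].
by rewrite /pinv /pmap /= row_mxKl row_mxKr !cmapK ?inE.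
Qed.

Fact prod_cmap_cont : {in pdom, continuous pmap}.
Proof.
move=> [p q]; rewrite inE => -[/= cp dq]; apply: row_mx_cvg.
  by apply: (cvg_comp _ _ cvg_fst); apply: cmap_cont; rewrite inE.
by apply: (cvg_comp _ _ cvg_snd); apply: cmap_cont; rewrite inE.
Qed.

Fact prod_cinv_cont : {in pmap @` pdom, continuous pinv}.
Proof.
move=> u; rewrite inE prod_imgE => -[/= cu du].
have cl : {for u, continuous (cinv c \o lsubmx)}.
  apply: continuous_comp; first exact: continuous_lsubmx.
  by apply: cinv_cont; rewrite inE.
have cr : {for u, continuous (cinv d \o rsubmx)}.
  apply: continuous_comp; first exact: continuous_rsubmx.
  by apply: cinv_cont; rewrite inE.
exact: (cvg_pair cl cr).
Qed.

Definition prod_chart : chart R (m + n) (M * N)%type :=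
  Chart prod_cdom_open prod_cimg_open prod_cmapK prod_cmap_cont prod_cinv_cont.

End ProductChart.

Variables M N : manifold R.

Definition prod_atlas : set (chart R (dim M + dim N) (M * N)%type) :=
  [set e | exists c d, [/\ atlas c, atlas d & e = prod_chart c d]].

Fact prod_cover (z : M * N) : exists2 e, prod_atlas e & cdom e z.
Proof.
have [[c ac cz] [d ad dz]] := (atlas_cover z.1, atlas_cover z.2).
by exists (prod_chart c d) => //; exists c, d.
Qed.

Fact prod_compat e e' : prod_atlas e -> prod_atlas e' ->
  smooth_on (cmap e @` (cdom e `&` cdom e')) (cmap e' \o cinv e).
Proof.
move=> [c [d [ac ad ->]]] [c' [d' [ac' ad' ->]]].
set U := _ @` _.
have -> : cmap (prod_chart c' d') \o cinv (prod_chart c d) =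
    (rowl \o ((cmap c' \o cinv c) \o lsubmx)) +
    (rowr \o ((cmap d' \o cinv d) \o rsubmx)).
  by apply/funext => u; rewrite !fctE /= row_mx_lr.
have UE : U = lsubmx @^-1` (cmap c @` (cdom c `&` cdom c')) `&`
              rsubmx @^-1` (cmap d @` (cdom d `&` cdom d')).
  rewrite -prod_imgE /U; congr image.
  by apply/seteqP; split=> [z [[? ?] [? ?]]|z [[? ?] [? ?]]].
have oU : open U by apply: open_cimg; exact: cdom_open.
apply: smooth_onD => //; apply: smooth_on_linl => //.
- exact: rowl_continuous.
- apply: smooth_on_sub (smooth_on_linr (@continuous_lsubmx _ _ _ _) _ (atlas_compat ac ac')).
    by rewrite UE => u [].
  by apply: open_cimg; exact: cdom_open.
- exact: rowr_continuous.
- apply: smooth_on_sub (smooth_on_linr (@continuous_rsubmx _ _ _ _) _ (atlas_compat ad ad')).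
    by rewrite UE => u [].
  by apply: open_cimg; exact: cdom_open.
Qed.

Definition prod_manifold : manifold R :=
  @Manifold R (M * N)%type (dim M + dim N) prod_atlas
    (hausdorff_prod (@manifold_hausdorff _ M) (@manifold_hausdorff _ N))
    (second_countable_prod (@manifold_second_countable _ M)
      (@manifold_second_countable _ N))
    prod_cover prod_compat.

End ProductManifold.

Section SmoothFun.
Context {R : realType} {M : manifold R}.
Implicit Types (U : set M) (h k : M -> R) (p : M).

Definition smooth_fun U h := forall c, atlas c ->
  smooth_on (cmap c @` (cdom c `&` U)) (h \o cinv c).

Definition smooth_near p h := exists2 U, open_nbhs p U & smooth_fun U h.

Lemma smooth_fun_sub U U' h : U' `<=` U -> smooth_fun U h -> smooth_fun U' h.
Proof.
move=> sU sh c ac; apply: smooth_on_sub (sh c ac).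
by apply: image_subset; exact: setIS.
Qed.

Lemma smooth_fun_lin U a h k : open U -> smooth_fun U h -> smooth_fun U k ->
  smooth_fun U (fun q => a * h q + k q).
Proof.
move=> oU sh sk c ac; have oc := @open_cimg _ _ _ c _ oU.
apply: (smooth_onD (f := ( *:%R a : R -> R) \o (h \o cinv c))) (sk c ac) => //.
by apply: smooth_on_linl (sh c ac) => //; exact: scaler_continuous.
Qed.

Lemma smooth_funM U h k : open U -> smooth_fun U h -> smooth_fun U k ->
  smooth_fun U (fun q => h q * k q).
Proof.
move=> oU sh sk c ac; have oc := @open_cimg _ _ _ c _ oU.
exact: (smooth_onM oc (sh c ac) (sk c ac)).
Qed.

Lemma smooth_nearP2 p h k : smooth_near p h -> smooth_near p k ->
  exists2 U, open_nbhs p U & smooth_fun U h /\ smooth_fun U k.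
Proof.
move=> [U [oU Up] sh] [U' [oU' Up'] sk]; exists (U `&` U').
  by split=> //; exact: openI.
by split; [apply: smooth_fun_sub sh|apply: smooth_fun_sub sk] => ? [].
Qed.

Lemma smooth_near_lin p a h k : smooth_near p h -> smooth_near p k ->
  smooth_near p (fun q => a * h q + k q).
Proof.
move=> sh sk; have [U [oU Up] [{}sh {}sk]] := smooth_nearP2 sh sk.
by exists U => //; exact: smooth_fun_lin.
Qed.

Lemma smooth_nearM p h k : smooth_near p h -> smooth_near p k ->
  smooth_near p (fun q => h q * k q).
Proof.
move=> sh sk; have [U [oU Up] [{}sh {}sk]] := smooth_nearP2 sh sk.
by exists U => //; exact: smooth_funM.
Qed.

End SmoothFun.

(* Tangent vectors at [p] are the derivations on germs at [p] of smooth
   functions. A germ is represented by a function on all of [M] that is smooth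
   near [p]; [tangent_junk] makes equal derivations Leibniz-equal. *)
Record tangent {R : realType} {M : manifold R} (p : M) := Tangent {
  tact :> (M -> R) -> R;
  tangent_germ : forall h k, smooth_near p h -> smooth_near p k ->
    (\forall q \near p, h q = k q) -> tact h = tact k;
  tangent_linear : forall a h k, smooth_near p h -> smooth_near p k ->
    tact (fun q => a * h q + k q) = a * tact h + tact k;
  tangent_leibniz : forall h k, smooth_near p h -> smooth_near p k ->
    tact (fun q => h q * k q) = tact h * k p + h p * tact k;
  tangent_junk : forall h, ~ smooth_near p h -> tact h = 0 }.

Section TangentSpace.
Context {R : realType} {M : manifold R} {p : M}.
Implicit Types u v w : tangent p.

Lemma tangent_eq u v : tact u = tact v -> u = v.
Proof.
case: u v => [f a b c d] [g a' b' c' d'] /= fg; subst g.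
by congr Tangent; exact: Prop_irrelevance.
Qed.

HB.instance Definition _ := gen_eqMixin (tangent p).
HB.instance Definition _ := gen_choiceMixin (tangent p).

#[local] Obligation Tactic := idtac.

Program Definition tangent_zero : tangent p := @Tangent R M p (fun _ => 0) _ _ _ _.
Next Obligation. by []. Qed.
Next Obligation. by move=> *; rewrite mulr0 addr0. Qed.
Next Obligation. by move=> *; rewrite mul0r mulr0 addr0. Qed.
Next Obligation. by []. Qed.

Program Definition tangent_add u v : tangent p :=
  @Tangent R M p (fun h => u h + v h) _ _ _ _.
Next Obligation.
by move=> u v h k sh sk hk /=; rewrite (tangent_germ u sh sk hk) (tangent_germ v sh sk hk).
Qed.
Next Obligation.
by move=> u v a h k sh sk /=; rewrite !tangent_linear//; ring.
Qed.
Next Obligation.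
by move=> u v h k sh sk /=; rewrite !tangent_leibniz//; ring.
Qed.
Next Obligation. by move=> u v h nh /=; rewrite !tangent_junk// addr0. Qed.

Program Definition tangent_scale (a : R) u : tangent p :=
  @Tangent R M p (fun h => a * u h) _ _ _ _.
Next Obligation.
by move=> a u h k sh sk hk /=; rewrite (tangent_germ u sh sk hk).
Qed.
Next Obligation. by move=> a u b h k sh sk /=; rewrite !tangent_linear//; ring. Qed.
Next Obligation. by move=> a u h k sh sk /=; rewrite !tangent_leibniz//; ring. Qed.
Next Obligation. by move=> a u h nh /=; rewrite !tangent_junk// mulr0. Qed.

Fact tangent_addA : associative tangent_add.
Proof. by move=> u v w; apply: tangent_eq; apply/funext => h /=; ring. Qed.
Fact tangent_addC : commutative tangent_add.
Proof. by move=> u v; apply: tangent_eq; apply/funext => h /=; ring. Qed.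
Fact tangent_add0 : left_id tangent_zero tangent_add.
Proof. by move=> u; apply: tangent_eq; apply/funext => h /=; ring. Qed.
Fact tangent_addN : left_inverse tangent_zero (tangent_scale (-1)) tangent_add.
Proof. by move=> u; apply: tangent_eq; apply/funext => h /=; ring. Qed.
HB.instance Definition _ := GRing.isZmodule.Build (tangent p)
  tangent_addA tangent_addC tangent_add0 tangent_addN.

Fact tangent_scaleA a b u :
  tangent_scale a (tangent_scale b u) = tangent_scale (a * b) u.
Proof. by apply: tangent_eq; apply/funext => h /=; ring. Qed.
Fact tangent_scale1 : left_id 1 tangent_scale.
Proof. by move=> u; apply: tangent_eq; apply/funext => h /=; ring. Qed.
Fact tangent_scaleDr : right_distributive tangent_scale +%R.
Proof. by move=> a u v; apply: tangent_eq; apply/funext => h /=; ring. Qed.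
Fact tangent_scaleDl u : {morph tangent_scale^~ u : a b / a + b}.
Proof. by move=> a b; apply: tangent_eq; apply/funext => h /=; ring. Qed.
HB.instance Definition _ := GRing.Zmodule_isLmodule.Build R (tangent p)
  tangent_scaleA tangent_scale1 tangent_scaleDr tangent_scaleDl.

End TangentSpace.

(* Equivalent to smoothness in charts: pull back the coordinate functions one
   way, use the chain rule the other way. *)
Record smooth_map {R : realType} {M N : manifold R} (phi : M -> N) : Prop := {
  smooth_map_cont : continuous phi;
  smooth_map_comp : forall p k,
    smooth_near (phi p) k -> smooth_near p (k \o phi) }.

Section Differential.
Context {R : realType} {M N : manifold R} {phi : M -> N}.
Variable sphi : smooth_map phi.

Section AtPoint.
Variables (p : M) (v : tangent p).

Let act (k : N -> R) : R :=
  if `[< smooth_near (phi p) k >] then v (k \o phi) else 0.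

Let actE k : smooth_near (phi p) k -> act k = v (k \o phi).
Proof. by move=> sk; rewrite /act asboolT. Qed.

Fact dmap_germ h k : smooth_near (phi p) h -> smooth_near (phi p) k ->
  (\forall q \near phi p, h q = k q) -> act h = act k.
Proof.
move=> sh sk hk; rewrite !actE//.
apply: tangent_germ; [exact: smooth_map_comp..|].
exact: (smooth_map_cont sphi) hk.
Qed.

Fact dmap_linear a h k : smooth_near (phi p) h -> smooth_near (phi p) k ->
  act (fun q => a * h q + k q) = a * act h + act k.
Proof.
move=> sh sk; rewrite !actE//; last exact: smooth_near_lin.
have [sh' sk'] := (smooth_map_comp sphi sh, smooth_map_comp sphi sk).
exact: (tangent_linear v a sh' sk').
Qed.

Fact dmap_leibniz h k : smooth_near (phi p) h -> smooth_near (phi p) k ->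
  act (fun q => h q * k q) = act h * k (phi p) + h (phi p) * act k.
Proof.
move=> sh sk; rewrite !actE//; last exact: smooth_nearM.
have [sh' sk'] := (smooth_map_comp sphi sh, smooth_map_comp sphi sk).
exact: (tangent_leibniz v sh' sk').
Qed.

Fact dmap_junk h : ~ smooth_near (phi p) h -> act h = 0.
Proof. by move=> nh; rewrite /act asboolF. Qed.

Definition dmap : tangent (phi p) :=
  Tangent dmap_germ dmap_linear dmap_leibniz dmap_junk.

End AtPoint.

Fact dmap_is_linear p : linear (@dmap p).
Proof.
move=> a u v; apply: tangent_eq; apply/funext => k /=.
by case: asboolP => // _; rewrite mulr0 addr0.
Qed.
HB.instance Definition _ p :=
  GRing.isLinear.Build R (tangent p) (tangent (phi p)) _ (@dmap p)
    (@dmap_is_linear p).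

End Differential.

Section Projections.
Context {R : realType} {M N : manifold R}.
Local Notation MN := (prod_manifold M N).

Lemma smooth_map_fst : smooth_map (fst : MN -> M).
Proof.
split=> [z|z k [U [oU Uz] sk]]; first exact: cvg_fst.
exists (fst @^-1` U).
  by split=> //; apply: open_comp => // ? _; exact: cvg_fst.
move=> _ [c [d [ac ad ->]]].
have oc := @open_cimg _ _ _ c _ oU.
apply: smooth_on_sub
  (smooth_on_linr (@continuous_lsubmx _ _ _ _) oc (sk c ac)) => _ [y [[/= cy dy] Uy] <-].
by rewrite /= row_mxKl; exists y.1.
Qed.

Lemma smooth_map_snd : smooth_map (snd : MN -> N).
Proof.
split=> [z|z k [U [oU Uz] sk]]; first exact: cvg_snd.
exists (snd @^-1` U).
  by split=> //; apply: open_comp => // ? _; exact: cvg_snd.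
move=> _ [c [d [ac ad ->]]].
have od := @open_cimg _ _ _ d _ oU.
apply: smooth_on_sub
  (smooth_on_linr (@continuous_rsubmx _ _ _ _) od (sk d ad)) => _ [y [[/= cy dy] Uy] <-].
by rewrite /= row_mxKr; exists y.2.
Qed.

Definition dfst (z : MN) : {linear tangent z -> tangent z.1} :=
  dmap smooth_map_fst (p := z).
Definition dsnd (z : MN) : {linear tangent z -> tangent z.2} :=
  dmap smooth_map_snd (p := z).

End Projections.

Record vfield {R : realType} (M : manifold R) := VField {
  vval :> forall p : M, tangent p;
  vfield_smooth : forall (U : set M) k, open U -> smooth_fun U k ->
    smooth_fun U (fun p => vval p k) }.

Section Bracket.
Context {R : realType} {M : manifold R}.

Lemma vfield_near (X : vfield M) p k :
  smooth_near p k -> smooth_near p (fun q => X q k).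
Proof. by move=> [U [oU Up] sk]; exists U => //; exact: vfield_smooth. Qed.

Lemma near_smooth_near p (k : M -> R) :
  smooth_near p k -> \forall q \near p, smooth_near q k.
Proof.
move=> [U [oU Up] sk]; apply: filterS (open_nbhs_nbhs (conj oU Up)).
by move=> q Uq; exists U.
Qed.

Variables X Y : vfield M.

Section AtPoint.
Variable p : M.

Let act (k : M -> R) : R :=
  if `[< smooth_near p k >]
  then X p (fun q => Y q k) - Y p (fun q => X q k) else 0.

Let actE k : smooth_near p k ->
  act k = X p (fun q => Y q k) - Y p (fun q => X q k).
Proof. by move=> sk; rewrite /act asboolT. Qed.

Fact bracket_germ h k : smooth_near p h -> smooth_near p k ->
  (\forall q \near p, h q = k q) -> act h = act k.
Proof.
move=> sh sk hk; rewrite !actE//.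
have E (Z : vfield M) : \forall q \near p, Z q h = Z q k.
  have := near_join hk.
  apply: filter_app3 (near_smooth_near sh) (near_smooth_near sk).
  by near=> q => shq skq hkq; exact: tangent_germ.
by congr (_ - _); apply: tangent_germ => //; exact: vfield_near.
Unshelve. all: by end_near. Qed.

Fact bracket_linear a h k : smooth_near p h -> smooth_near p k ->
  act (fun q => a * h q + k q) = a * act h + act k.
Proof.
move=> sh sk; have shk := smooth_near_lin a sh sk.
have E (Z Z' : vfield M) : Z p (fun q => Z' q (fun q => a * h q + k q)) =
    a * Z p (fun q => Z' q h) + Z p (fun q => Z' q k).
  have [sZh sZk] := (vfield_near Z' sh, vfield_near Z' sk).
  rewrite -tangent_linear//; apply: tangent_germ; first exact: vfield_near.
    exact: smooth_near_lin.
  apply: filter_app2 (near_smooth_near sh) (near_smooth_near sk).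
  by near=> q => shq skq; exact: tangent_linear.
by rewrite !actE// !E; ring.
Unshelve. all: by end_near. Qed.

Fact bracket_leibniz h k : smooth_near p h -> smooth_near p k ->
  act (fun q => h q * k q) = act h * k p + h p * act k.
Proof.
move=> sh sk; have shk := smooth_nearM sh sk.
have E (Z Z' : vfield M) : Z p (fun q => Z' q (fun q => h q * k q)) =
    Z p (fun q => Z' q h) * k p + Z' p h * Z p k +
    (Z p h * Z' p k + h p * Z p (fun q => Z' q k)).
  have [sZh sZk] := (vfield_near Z' sh, vfield_near Z' sk).
  rewrite -!tangent_leibniz// -[X in X + _]mul1r -tangent_linear//; first last.
  - exact: smooth_nearM.
  - exact: smooth_nearM.
  apply: tangent_germ; first exact: vfield_near.
    by apply: smooth_near_lin; exact: smooth_nearM.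
  apply: filter_app2 (near_smooth_near sh) (near_smooth_near sk).
  by near=> q => shq skq; rewrite tangent_leibniz// mul1r.
by rewrite !actE// !E; ring.
Unshelve. all: by end_near. Qed.

Fact bracket_junk h : ~ smooth_near p h -> act h = 0.
Proof. by move=> nh; rewrite /act asboolF. Qed.

Definition bracket_at : tangent p :=
  Tangent bracket_germ bracket_linear bracket_leibniz bracket_junk.

End AtPoint.

Fact bracket_smooth (U : set M) k : open U -> smooth_fun U k ->
  smooth_fun U (fun p => bracket_at p k).
Proof.
move=> oU sk c ac; have oc := @open_cimg _ _ _ c _ oU.
have sYX := vfield_smooth Y oU (vfield_smooth X oU sk).
have sXY := vfield_smooth X oU (vfield_smooth Y oU sk).
apply: smooth_on_eq (smooth_fun_lin (-1) oU sYX sXY ac) => //.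
move=> _ [p [cp Up] <-] /=; rewrite cmapK ?inE//.
rewrite asboolT; first by ring.
by exists U.
Qed.

Definition bracket : vfield M := VField bracket_smooth.

End Bracket.

Record symtensor {R : realType} (M : manifold R) := SymTensor {
  tval :> forall p : M, tangent p -> tangent p -> R;
  tval_sym : forall p u v, @tval p u v = @tval p v u;
  tval_linear : forall p u, scalar (@tval p u) }.

Section Metric.
Context {R : realType} {M : manifold R}.

Definition inner (g : symtensor M) (X Y : vfield M) : M -> R :=
  fun p => g p (X p) (Y p).

(* Manifolds being Hausdorff, local fields extend by bump functions, so global
   fields suffice to test smoothness. *)
Definition smooth_tensor (g : symtensor M) :=
  forall X Y : vfield M, smooth_fun setT (inner g X Y).

Definition koszul (g : symtensor M) (X Y Z : vfield M) : M -> R := fun p =>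
  2^-1 * (X p (inner g Y Z) + Y p (inner g Z X) - Z p (inner g X Y)
    - inner g X (bracket Y Z) p + inner g Y (bracket Z X) p
    + inner g Z (bracket X Y) p).

(* semi-symmetric non-metric Koszul form associated with [P] *)
Definition koszul_ssnm (g : symtensor M) (P X Y Z : vfield M) : M -> R := fun p =>
  koszul g X Y Z p + inner g Y P p * inner g X Z p.

End Metric.

Section WarpedProduct.
Context {R : realType} {B F : manifold R}.
Local Notation BF := (prod_manifold B F).

Section Tensor.
Variables (gB : symtensor B) (gF : symtensor F) (f : B -> R).

Let val (z : BF) (u v : tangent z) : R :=
  gB z.1 (dfst z u) (dfst z v) + f z.1 ^+ 2 * gF z.2 (dsnd z u) (dsnd z v).

Fact warped_sym z u v : @val z u v = val v u.
Proof. by rewrite /val tval_sym (tval_sym gF). Qed.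

Fact warped_linear z u : scalar (@val z u).
Proof.
move=> a v w; rewrite /val !linearP.
by rewrite (tval_linear gB) (tval_linear gF)/=; ring.
Qed.

Definition warped : symtensor BF := SymTensor warped_sym warped_linear.

End Tensor.

(* [Xt] is the lift to [B * F] of a vector field [X] on [B] (resp. on [F]):
   the unique field that projects to [X] on that factor and to [0] on the other. *)
Definition lift_fst (X : vfield B) (Xt : vfield BF) :=
  forall z : BF, dfst z (Xt z) = X z.1 /\ dsnd z (Xt z) = 0.
Definition lift_snd (X : vfield F) (Xt : vfield BF) :=
  forall z : BF, dfst z (Xt z) = 0 /\ dsnd z (Xt z) = X z.2.

End WarpedProduct.

(* Main.v *)
(* Call a field on the product the lift of (A, A') when it projects to A on B
   and to A' on F. Brackets of related fields are related, so brackets of lifts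
   are lifts of the brackets, and the warped metric only sees the two
   projections. Hence the Koszul form of lifts of (A, A'), (C, C'), (E, E') is
   K_B(A,C,E) + f^2 K_F(A',C',E')
     + f (A(f) g_F(C',E') + C(f) g_F(E',A') - E(f) g_F(A',C')),
   the last part coming from the Leibniz rule applied to f^2 g_F. The lifts
   of X and of V are those of (X, 0) and (0, V), and each case follows by
   deleting the terms that contain a zero field. *)
Require Import Defs.
From mathcomp Require Import all_boot all_order all_algebra.
From mathcomp Require Import all_classical all_reals all_analysis.
From mathcomp Require Import ring.
Set Implicit Arguments.
Unset Strict Implicit.
Unset Printing Implicit Defensive.
Import Order.TTheory GRing.Theory Num.Theory.
Import numFieldNormedType.Exports.
Local Open Scope classical_set_scope.
Local Open Scope ring_scope.

Section Derivations.
Context {R : realType} {M : manifold R}.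

Lemma smooth_nearT (p : M) (h : M -> R) : smooth_fun setT h -> smooth_near p h.
Proof. by move=> sh; exists setT => //; split => //; exact: openT. Qed.

Lemma tangentD (p : M) (v : tangent p) (h k : M -> R) :
  smooth_near p h -> smooth_near p k -> v (fun q => h q + k q) = v h + v k.
Proof.
move=> sh sk; have := tangent_linear v 1 sh sk.
by under [in LHS]eq_fun do rewrite mul1r; rewrite mul1r.
Qed.

(** If the zero function is smooth near [p], additivity gives v(0) = v(0) + v(0); otherwise the
    value is 0 by [tangent_junk]. *)
Lemma tangent0 (p : M) (v : tangent p) : v (fun=> 0) = 0.
Proof.
case: (pselect (smooth_near p (fun=> 0 : R))) => [s0|]; last exact: tangent_junk.
have := tangentD v s0 s0.
under [in LHS]eq_fun do rewrite addr0.
by move/eqP; rewrite -subr_eq0 opprD addrA subrr sub0r oppr_eq0 => /eqP.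
Qed.

Fact zero_field_smooth (U : set M) (k : M -> R) : open U -> smooth_fun U k ->
  smooth_fun U (fun p => (0 : tangent p) k).
Proof.
(* Writing 0 as -k + k derives its smoothness from that of [k]. *)
move=> oU sk; have -> : (fun p => (0 : tangent p) k) = (fun p => -1 * k p + k p).
  by apply/funext => p; rewrite mulN1r addNr.
exact: smooth_fun_lin.
Qed.

(** Serves as the component of a lifted field along the opposite factor. *)
Definition zero_field : vfield M := VField zero_field_smooth.

Lemma bracketE (X Y : vfield M) (p : M) (k : M -> R) : smooth_near p k ->
  bracket X Y p k = X p (fun q => Y q k) - Y p (fun q => X q k).
Proof. by move=> sk; rewrite /= asboolT. Qed.

Lemma bracket0l (X : vfield M) (p : M) : bracket zero_field X p = 0.
Proof.
apply: tangent_eq; apply/funext => k.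
case: (pselect (smooth_near p k)) => sk; last by rewrite !tangent_junk.
by rewrite bracketE// tangent0 subr0.
Qed.

Lemma bracket0r (X : vfield M) (p : M) : bracket X zero_field p = 0.
Proof.
apply: tangent_eq; apply/funext => k.
case: (pselect (smooth_near p k)) => sk; last by rewrite !tangent_junk.
by rewrite bracketE// tangent0 subr0.
Qed.

End Derivations.

Section ZeroField.
Context {R : realType} {M : manifold R} (g : symtensor M).

Lemma symtensor0r (p : M) (u : tangent p) : g p u 0 = 0.
Proof.
have := tval_linear g u 1 0 0; rewrite scaler0 addr0 mul1r.
by move/eqP; rewrite -subr_eq0 opprD addrA subrr sub0r oppr_eq0 => /eqP.
Qed.

Lemma symtensor0l (p : M) (u : tangent p) : g p 0 u = 0.
Proof. by rewrite tval_sym symtensor0r. Qed.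

Lemma inner0l (X : vfield M) : inner g zero_field X = fun=> 0.
Proof. by apply/funext => p; exact: symtensor0l. Qed.

Lemma inner0r (X : vfield M) : inner g X zero_field = fun=> 0.
Proof. by apply/funext => p; exact: symtensor0r. Qed.

Lemma koszul0l (Y Z : vfield M) (p : M) : koszul g zero_field Y Z p = 0.
Proof.
rewrite /koszul !inner0l !inner0r !tangent0 /inner bracket0l bracket0r.
by rewrite !symtensor0r /=; ring.
Qed.

Lemma koszul0m (X Z : vfield M) (p : M) : koszul g X zero_field Z p = 0.
Proof.
rewrite /koszul !inner0l !inner0r !tangent0 /inner bracket0l bracket0r.
by rewrite !symtensor0r /=; ring.
Qed.

Lemma koszul0r (X Y : vfield M) (p : M) : koszul g X Y zero_field p = 0.
Proof.
rewrite /koszul !inner0l !inner0r !tangent0 /inner bracket0l bracket0r.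
by rewrite !symtensor0r /=; ring.
Qed.

Definition zero_fieldE := (koszul0l, koszul0m, koszul0r, inner0l, inner0r).

End ZeroField.

Section Related.
Context {R : realType} {M N : manifold R} {phi : M -> N}.
Variable sphi : smooth_map phi.

(** The usual phi-relatedness, which makes sense even where fields cannot be pushed forward, as for
    the projections. *)
Definition related (Xt : vfield M) (X : vfield N) :=
  forall p, dmap sphi (Xt p) = X (phi p).

Lemma related_comp Xt X p k : related Xt X -> smooth_near (phi p) k ->
  Xt p (k \o phi) = X (phi p) k.
Proof. by move=> rX sk; rewrite -rX /= asboolT. Qed.

(** Using relatedness twice, At(Ct(k o phi)) = A(C k) o phi for each order of the two fields;
    subtracting gives the brackets. *)
Lemma related_bracket Xt X Yt Y : related Xt X -> related Yt Y ->
  related (bracket Xt Yt) (bracket X Y).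
Proof.
move=> rX rY p; apply: tangent_eq; apply/funext => k.
case: (pselect (smooth_near (phi p) k)) => sk; last by rewrite !tangent_junk.
rewrite bracketE// [LHS]/= asboolT// -/(bracket Xt Yt p (k \o phi)).
have skp := smooth_map_comp sphi sk.
have E (At Ct : vfield M) (A C : vfield N) : related At A -> related Ct C ->
    At p (fun q => Ct q (k \o phi)) = A (phi p) (fun q => C q k).
  move=> rA rC; rewrite -(related_comp rA); last exact: vfield_near.
  apply: tangent_germ; first exact: vfield_near.
    by apply: (smooth_map_comp sphi); exact: vfield_near.
  (* The inner identity Ct(k o phi) = (C k) o phi is available only at points [q] with [k] smooth
     near phi(q). By continuity these fill a neighbourhood of [p], which suffices for a derivation
     on germs. *)
  have : \forall q \near p, smooth_near (phi q) k.
    exact: (smooth_map_cont sphi) (near_smooth_near sk).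
  apply: filterS => q skq.
  exact: (related_comp rC skq).
by rewrite asboolT// (E _ _ _ _ rX rY) (E _ _ _ _ rY rX).
Qed.

End Related.

Section WarpedKoszul.
Context {R : realType} {B F : manifold R}.
Local Notation BF := (prod_manifold B F).
Variables (gB : symtensor B) (gF : symtensor F) (f : B -> R).
Hypotheses (hgB : smooth_tensor gB) (hgF : smooth_tensor gF).
Hypothesis hf : smooth_fun setT f.
Local Notation g := (warped gB gF f).

Definition lift (X : vfield B) (U : vfield F) (T : vfield BF) :=
  related smooth_map_fst T X /\ related smooth_map_snd T U.

Lemma lift_fstP X T : lift_fst X T -> lift X zero_field T.
Proof. by move=> hT; split=> z; case: (hT z). Qed.

Lemma lift_sndP U T : lift_snd U T -> lift zero_field U T.
Proof. by move=> hT; split=> z; case: (hT z). Qed.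

Lemma lift_bracket X1 U1 T1 X2 U2 T2 : lift X1 U1 T1 -> lift X2 U2 T2 ->
  lift (bracket X1 X2) (bracket U1 U2) (bracket T1 T2).
Proof. by move=> [? ?] [? ?]; split; exact: related_bracket. Qed.

Lemma inner_warped X1 U1 T1 X2 U2 T2 (z : BF) : lift X1 U1 T1 -> lift X2 U2 T2 ->
  inner g T1 T2 z =
    inner gB X1 X2 z.1 + f z.1 ^+ 2 * inner gF U1 U2 z.2.
Proof.
move=> [rX1 rU1] [rX2 rU2]; rewrite /inner /= /dfst /dsnd.
by rewrite rX1 rX2 rU1 rU2.
Qed.

(** [T1] acts as [X1] on functions from [B] and as [U1] on functions from [F]; the last summand is
    X1(f^2) times the metric of [F]. *)
Lemma deriv_inner_warped X1 U1 T1 X2 U2 T2 X3 U3 T3 (z : BF) :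
  lift X1 U1 T1 -> lift X2 U2 T2 -> lift X3 U3 T3 ->
  T1 z (inner g T2 T3) =
    X1 z.1 (inner gB X2 X3) + f z.1 ^+ 2 * U1 z.2 (inner gF U2 U3) +
    2 * f z.1 * X1 z.1 f * inner gF U2 U3 z.2.
Proof.
move=> [rX1 rU1] l2 l3.
(* The square is split as f * f so that the Leibniz rule applies twice. *)
have -> : inner g T2 T3 = fun z : BF => (inner gB X2 X3 \o fst) z +
    ((f \o fst) z * (f \o fst) z) * (inner gF U2 U3 \o snd) z.
  by apply/funext => y; rewrite (inner_warped _ l2 l3) expr2.
have sB : smooth_near z.1 (inner gB X2 X3) by exact/smooth_nearT/hgB.
have sF : smooth_near z.2 (inner gF U2 U3) by exact/smooth_nearT/hgF.
have sf : smooth_near z.1 f by exact/smooth_nearT.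
have sB' := smooth_map_comp (smooth_map_fst (M := B) (N := F)) sB.
have sF' := smooth_map_comp (smooth_map_snd (M := B) (N := F)) sF.
have sf' := smooth_map_comp (smooth_map_fst (M := B) (N := F)) sf.
have sff' := smooth_nearM sf' sf'.
rewrite tangentD//; last exact: smooth_nearM.
rewrite (tangent_leibniz _ sff' sF') (tangent_leibniz _ sf' sf').
by rewrite (related_comp rX1 sB) (related_comp rX1 sf) (related_comp rU1 sF) /=; ring.
Qed.

(** The brackets and the undifferentiated f^2 assemble into the two Koszul forms; the terms 2 f
    X_i(f) remain, and their 2 cancels the factor 1/2. *)
Lemma koszul_warped X1 U1 T1 X2 U2 T2 X3 U3 T3 (z : BF) :
  lift X1 U1 T1 -> lift X2 U2 T2 -> lift X3 U3 T3 ->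
  koszul g T1 T2 T3 z =
    koszul gB X1 X2 X3 z.1 + f z.1 ^+ 2 * koszul gF U1 U2 U3 z.2 +
    f z.1 * (X1 z.1 f * inner gF U2 U3 z.2 + X2 z.1 f * inner gF U3 U1 z.2
             - X3 z.1 f * inner gF U1 U2 z.2).
Proof.
move=> l1 l2 l3; rewrite /koszul.
rewrite (deriv_inner_warped _ l1 l2 l3) (deriv_inner_warped _ l2 l3 l1).
rewrite (deriv_inner_warped _ l3 l1 l2).
rewrite (inner_warped _ l1 (lift_bracket l2 l3)).
rewrite (inner_warped _ l2 (lift_bracket l3 l1)).
by rewrite (inner_warped _ l3 (lift_bracket l1 l2)); field.
Qed.

Lemma koszul_ssnm_warped X1 U1 T1 X2 U2 T2 X3 U3 T3 Y V Q (z : BF) :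
  lift X1 U1 T1 -> lift X2 U2 T2 -> lift X3 U3 T3 -> lift Y V Q ->
  koszul_ssnm g Q T1 T2 T3 z =
    koszul gB X1 X2 X3 z.1 + f z.1 ^+ 2 * koszul gF U1 U2 U3 z.2 +
    f z.1 * (X1 z.1 f * inner gF U2 U3 z.2 + X2 z.1 f * inner gF U3 U1 z.2
             - X3 z.1 f * inner gF U1 U2 z.2) +
    (inner gB X2 Y z.1 + f z.1 ^+ 2 * inner gF U2 V z.2) *
    (inner gB X1 X3 z.1 + f z.1 ^+ 2 * inner gF U1 U3 z.2).
Proof.
move=> l1 l2 l3 l4; rewrite /koszul_ssnm (koszul_warped _ l1 l2 l3).
by rewrite (inner_warped _ l2 l4) (inner_warped _ l1 l3).
Qed.

End WarpedKoszul.

Theorem proposition3p14 (R : realType) (B F : manifold R)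
    (gB : symtensor B) (hgB : smooth_tensor gB)
    (gF : symtensor F) (hgF : smooth_tensor gF)
    (f : B -> R) (hf : smooth_fun setT f)
    (X Y Z : vfield B) (U V W P : vfield F)
    (Xt Yt Zt Ut Vt Wt Pt : vfield (prod_manifold B F))
    (hX : lift_fst X Xt) (hY : lift_fst Y Yt) (hZ : lift_fst Z Zt)
    (hU : lift_snd U Ut) (hV : lift_snd V Vt) (hW : lift_snd W Wt)
    (hP : lift_snd P Pt) (z : prod_manifold B F) :
  [/\ (* (1) *)
      koszul_ssnm (warped gB gF f) Pt Xt Yt Zt z = koszul gB X Y Z z.1,
      (* (2) *)
      koszul_ssnm (warped gB gF f) Pt Xt Yt Wt z = 0 /\
      koszul_ssnm (warped gB gF f) Pt Wt Xt Yt z = 0,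
      (* (3) *)
      koszul_ssnm (warped gB gF f) Pt Xt Wt Yt z =
        f z.1 ^+ 2 * inner gB X Y z.1 * inner gF P W z.2,
      (* (4) *)
      [/\ koszul_ssnm (warped gB gF f) Pt Xt Vt Wt z =
            f z.1 * inner gF V W z.2 * X z.1 f,
          koszul_ssnm (warped gB gF f) Pt Vt Xt Wt z =
            f z.1 * inner gF V W z.2 * X z.1 f &
          - koszul_ssnm (warped gB gF f) Pt Vt Wt Xt z =
            f z.1 * inner gF V W z.2 * X z.1 f] &
      (* (5) *)
      koszul_ssnm (warped gB gF f) Pt Ut Vt Wt z =
        f z.1 ^+ 2 * koszul gF U V W z.2 +
        f z.1 ^+ 4 * inner gF V P z.2 * inner gF U W z.2].
Proof.
move: hX hY hZ => /lift_fstP lX /lift_fstP lY /lift_fstP lZ.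
move: hU hV hW hP => /lift_sndP lU /lift_sndP lV /lift_sndP lW /lift_sndP lP.
have symF (U1 U2 : vfield F) : inner gF U1 U2 z.2 = inner gF U2 U1 z.2.
  exact: tval_sym.
(* Since [P] has no component on [B], the correction g(T2,P) g(T1,T3) survives only if the second
   argument comes from [F] and the other two share a factor: this happens in (3) and (5), with
   coefficients f^2 and f^4. Derivatives of [f] along [zero_field] vanish by computation. *)
split; [|split| |split|].
- by rewrite (koszul_ssnm_warped hgB hgF hf _ lX lY lZ lP) !zero_fieldE /=; ring.
- by rewrite (koszul_ssnm_warped hgB hgF hf _ lX lY lW lP) !zero_fieldE /=; ring.
- by rewrite (koszul_ssnm_warped hgB hgF hf _ lW lX lY lP) !zero_fieldE /=; ring.
- by rewrite (koszul_ssnm_warped hgB hgF hf _ lX lW lY lP) !zero_fieldE (symF W P) /=; ring.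
- by rewrite (koszul_ssnm_warped hgB hgF hf _ lX lV lW lP) !zero_fieldE /=; ring.
- by rewrite (koszul_ssnm_warped hgB hgF hf _ lV lX lW lP) !zero_fieldE (symF W V) /=; ring.
- by rewrite (koszul_ssnm_warped hgB hgF hf _ lV lW lX lP) !zero_fieldE /=; ring.
- by rewrite (koszul_ssnm_warped hgB hgF hf _ lU lV lW lP) !zero_fieldE /=; ring.
Qed.
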